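(* Let $q$ be a prime and let $\mathcal{S}$ be a stabilizer code with parameters $[[n,k,d]]_q$. Then $\mathcal{S}$ can be transformed into an analog continuous-variable code with parameters $[[n,k,d']]_{\mathbb{R}}$ (i.e. $n$ physical continuous modes, $k$ logical continuous modes, distance $d'$), where $d'=d^*\geq d$.
   Context: For prime $q$, qudit Paulis are generated by $X|j\rangle=|j+1 \bmod q\rangle$, $Z|j\rangle=e^{2\pi i j/q}|j\rangle$. An $n$-register Pauli $\bigotimes_t X^{a_t}Z^{b_t}$ has integer representation $\phi_\infty=(\vec a\,|\,\vec b)\in\mathbb{Z}^{2n}$; the symplectic product is $(\vec a|\vec b)\odot(\vec a'|\vec b')=\vec a\cdot\vec b'-\vec a'\cdot\vec b$. A stabilizer code $[[n,k,d]]_q$ has $n-k$ independent generators with pairwise symplectic products $\equiv 0 \pmod q$; its distance $d$ is the minimum weight (number of non-identity tensor factors) of a Pauli commuting with all stabilizers but not in the stabilizer group. A local-dimension-invariant (LDI) form of $\mathcal{S}$ is a set of integer generator vectors, congruent modulo $q$ to generators of $\mathcal{S}$, whose pairwise integer symplectic products are exactly $0$. An unavoidable error is a Pauli (not in the stabilizer group) whose integer symplectic product with every LDI generator is exactly $0$; $d^*$ is the minimal weight of an unavoidable error. The analog continuous-variable code associated to an LDI form has, for each generator $(\vec a|\vec b)$, the nullifier $\vec a\cdot\vec x+\vec b\cdot\vec p$, where $x_1,\dots,x_n,p_1,\dots,p_n$ are quadrature operators with $[x_k,p_l]=\delta_{kl}$ and $[x_k,x_l]=[p_k,p_l]=0$;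 errors are displacements (continuous-valued Paulis) on the modes and the distance is the minimal number of modes acted on by an undetectable error acting nontrivially on the code space. *)

(* Defs.v *)
From HB Require Import structures.
From mathcomp Require Import all_boot all_order all_algebra.
From mathcomp Require Import reals.
Set Implicit Arguments. Unset Strict Implicit. Unset Printing Implicit Defensive.
Import Order.TTheory GRing.Theory Num.Theory.
Local Open Scope ring_scope.

(* An n-register (generalized) Pauli / displacement is encoded by the pair of
   row vectors (a | b) : 'rV_n * 'rV_n  (X-exponents | Z-exponents), resp.
   (x-coefficients | p-coefficients) for continuous variables.
   A family of m generators is a pair of matrices (GX, GZ) : 'M_(m,n),
   row i being generator i. *)

Definition sympl (T : pzRingType) (n : nat) (a b a' b' : 'rV[T]_n) : T :=
  \sum_(t < n) (a 0 t * b' 0 t - a' 0 t * b 0 t).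

Definition pweight (T : nmodType) (n : nat) (a b : 'rV[T]_n) : nat :=
  #|[set t : 'I_n | (a 0 t != 0) || (b 0 t != 0)]|.

Definition stab_code (q n k : nat) (SX SZ : 'M['F_q]_(n - k, n)) : Prop :=
  [/\ (k <= n)%N,
      \rank (row_mx SX SZ) = (n - k)%N &
      forall i j, sympl (row i SX) (row i SZ) (row j SX) (row j SZ) = 0].

(* membership of a Pauli (up to phase) in the stabilizer group *)
Definition in_stab (q n m : nat) (SX SZ : 'M['F_q]_(m, n)) (a b : 'rV['F_q]_n)
  : bool := (row_mx a b <= row_mx SX SZ)%MS.

Definition q_logical (q n m : nat) (SX SZ : 'M['F_q]_(m, n)) (a b : 'rV['F_q]_n)
  : Prop :=
  (forall i, sympl a b (row i SX) (row i SZ) = 0) /\ ~~ in_stab SX SZ a b.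

Definition q_distance (q n m : nat) (SX SZ : 'M['F_q]_(m, n)) (d : nat) : Prop :=
  (exists a b, q_logical SX SZ a b /\ pweight a b = d) /\
  (forall a b, q_logical SX SZ a b -> (d <= pweight a b)%N).

Definition modq (q : nat) (z : int) : 'F_q := z%:~R.

Definition LDI_form (q n m : nat) (SX SZ : 'M['F_q]_(m, n))
  (GX GZ : 'M[int]_(m, n)) : Prop :=
  (row_mx (map_mx (modq q) GX) (map_mx (modq q) GZ) == row_mx SX SZ)%MS /\
  (forall i j, sympl (row i GX) (row i GZ) (row j GX) (row j GZ) = 0).

Definition liftq (q : nat) (x : 'F_q) : int := (nat_of_ord x)%:Z.

Definition unavoidable (q n m : nat) (SX SZ : 'M['F_q]_(m, n))
  (GX GZ : 'M[int]_(m, n)) (a b : 'rV['F_q]_n) : Prop :=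
  (forall i, sympl (map_mx (@liftq q) a) (map_mx (@liftq q) b)
                   (row i GX) (row i GZ) = 0) /\ ~~ in_stab SX SZ a b.

Definition dstar (q n m : nat) (SX SZ : 'M['F_q]_(m, n))
  (GX GZ : 'M[int]_(m, n)) (d : nat) : Prop :=
  (exists a b, unavoidable SX SZ GX GZ a b /\ pweight a b = d) /\
  (forall a b, unavoidable SX SZ GX GZ a b -> (d <= pweight a b)%N).

Definition toR (R : realType) (z : int) : R := z%:~R.

(* Generator row i gives the nullifier  a.x + b.p ; the stabilizer group is
   generated by exp(i t (a.x + b.p)), t real, i.e. it corresponds to the real
   span of the generator vectors.  An error exp(i(u.x + v.p)) commutes with
   nullifier a.x+b.p iff the symplectic product (u|v).(a|b) is 0. *)
Definition cv_logical (R : realType) (n m : nat) (GX GZ : 'M[int]_(m, n))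
  (u v : 'rV[R]_n) : Prop :=
  (forall i, sympl u v (row i (map_mx (@toR R) GX)) (row i (map_mx (@toR R) GZ)) = 0)
  /\ ~~ (row_mx u v <= row_mx (map_mx (@toR R) GX) (map_mx (@toR R) GZ))%MS.

Definition cv_logical_modes (R : realType) (n m : nat) (GX GZ : 'M[int]_(m, n))
  (k : nat) : Prop :=
  \rank (row_mx (map_mx (@toR R) GX) (map_mx (@toR R) GZ)) = (n - k)%N /\ (k <= n)%N.

Definition cv_distance (R : realType) (n m : nat) (GX GZ : 'M[int]_(m, n))
  (d : nat) : Prop :=
  (exists u v, @cv_logical R n m GX GZ u v /\ pweight u v = d) /\
  (forall u v, @cv_logical R n m GX GZ u v -> (d <= pweight u v)%N).

(* Main.v *)
(** Let L be a logical Pauli of minimal weight d, with entries lifted to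
    {0, ..., q-1}.  The generators are lifted one at a time, after rescaling by
    units mod q, to an integer isotropic family G exactly orthogonal to L, so
    that L is unavoidable and d* = d.  To control the real distance as well,
    integer transvections v |-> v + c q <v, w> w with <L, w> = 0 are applied:
    they preserve all these properties and, for suitable w and c, strictly
    increase the rank of G restricted to a given set T of registers without
    decreasing any other such rank.  The process stops only when G has full rank
    2|T| on every T with |T| < d; this is possible since 2(d - 1) <= n - k
    (quantum Singleton bound) and since no such T contains the support of L.
    Full rank on T forces every real vector supported on T and orthogonal to G
    to vanish, so the continuous code has distance exactly d. *)

Require Import Defs.
From HB Require Import structures.
From mathcomp Require Import all_boot all_order all_algebra.
From mathcomp Require Import zify reals.
Import Order.TTheory GRing.Theory Num.Theory.
Local Open Scope ring_scope.

(** * The symplectic form as a matrix, and projections onto sets of registers *)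

Definition symp_mx {R : pzRingType} n : 'M[R]_(n + n) :=
  block_mx 0 1%:M (- 1%:M) 0.

Definition coord_proj {R : pzRingType} {n} (T : {set 'I_n}) : 'M[R]_n :=
  diag_mx (\row_t (t \in T)%:R).

(** The equation [x *m reg_proj T = x] encodes that [x] is supported on [T], so that support
    conditions become statements about ranks. *)
Definition reg_proj {R : pzRingType} {n} (T : {set 'I_n}) : 'M[R]_(n + n) :=
  block_mx (coord_proj T) 0 0 (coord_proj T).

Lemma tr_symp_mx (R : pzRingType) n : (@symp_mx R n)^T = - symp_mx n.
Proof.
by rewrite /symp_mx tr_block_mx !trmx0 linearN /= trmx1 opp_block_mx oppr0 opprK.
Qed.

Lemma symp_mx_sqr (R : pzRingType) n : @symp_mx R n *m symp_mx n = - 1%:M.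
Proof.
rewrite /symp_mx mulmx_block !mul0mx !mulmx0 !addr0 !add0r mulmx1 mulmxN mulmx1.
by rewrite scalar_mx_block opp_block_mx !oppr0.
Qed.

Lemma map_symp_mx (R S : pzRingType) (f : {rmorphism R -> S}) n :
  map_mx f (symp_mx n) = symp_mx n.
Proof. by rewrite map_block_mx map_mxN map_mx1 !map_mx0. Qed.

Lemma rank_mul_symp (F : fieldType) m n (A : 'M[F]_(m, n + n)) :
  \rank (A *m symp_mx n) = \rank A.
Proof.
apply/eqP; rewrite eqn_leq mxrankM_maxl /=.
have {1}-> : A = - (A *m symp_mx n *m symp_mx n).
  by rewrite -mulmxA symp_mx_sqr mulmxN mulmx1 opprK.
by rewrite mxrank_opp mxrankM_maxl.
Qed.

Lemma symplE (R : comPzRingType) n (a b a' b' : 'rV[R]_n) :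
  sympl a b a' b' = (row_mx a b *m symp_mx n *m (row_mx a' b')^T) 0 0.
Proof.
rewrite /symp_mx tr_row_mx mul_row_block !mulmx0 add0r addr0 mulmxN !mulmx1.
rewrite mul_row_col mulNmx !mxE -sumrN -big_split /=.
by apply: eq_bigr => t _; rewrite !mxE [a' 0 t * _]mulrC addrC.
Qed.

Lemma sympl_rowP (R : comPzRingType) m1 m2 n (X Z : 'M[R]_(m1, n))
    (X' Z' : 'M[R]_(m2, n)) :
  (forall i j, sympl (row i X) (row i Z) (row j X') (row j Z') = 0) <->
  row_mx X Z *m symp_mx n *m (row_mx X' Z')^T = 0.
Proof.
have E i j : sympl (row i X) (row i Z) (row j X') (row j Z') =
    (row_mx X Z *m symp_mx n *m (row_mx X' Z')^T) i j.
  rewrite symplE -!row_row_mx -!row_mul tr_row !mxE.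
  by apply: eq_bigr => t _; rewrite !mxE.
split=> [h | h i j]; last by rewrite E h mxE.
by apply/matrixP => i j; rewrite -E h mxE.
Qed.

Lemma sympl_vecP (R : comPzRingType) m n (u v : 'rV[R]_n) (X Z : 'M[R]_(m, n)) :
  (forall i, sympl u v (row i X) (row i Z) = 0) <->
  row_mx u v *m symp_mx n *m (row_mx X Z)^T = 0.
Proof.
rewrite -sympl_rowP; split=> h i; last by have := h 0 i; rewrite !row_id.
by move=> j; rewrite ord1 !row_id.
Qed.

Lemma symp_mx_orthC (R : comPzRingType) m1 m2 n (A : 'M[R]_(m1, n + n))
    (B : 'M[R]_(m2, n + n)) :
  A *m symp_mx n *m B^T = 0 -> B *m symp_mx n *m A^T = 0.
Proof.
move/(congr1 trmx); rewrite !trmx_mul trmxK tr_symp_mx trmx0 mulNmx mulmxN.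
by rewrite mulmxA => /eqP; rewrite oppr_eq0 => /eqP.
Qed.

Lemma symp_mx_self (R : comPzRingType) n (u : 'rV[R]_(n + n)) :
  u *m symp_mx n *m u^T = 0.
Proof.
apply/matrixP => i j; rewrite !ord1 -[u]hsubmxK -symplE [RHS]mxE.
by rewrite /sympl big1 // => t _; rewrite subrr.
Qed.

Lemma coord_proj_rank_le (F : fieldType) n (T : {set 'I_n}) :
  (\rank (@coord_proj F n T) <= #|T|)%N.
Proof.
have -> : coord_proj T =
    (\matrix_(i < n, j < #|T|) (i == enum_val j)%:R) *m
    (\matrix_(i < #|T|, j < n) (j == enum_val i)%:R) :> 'M[F]_n.
  apply/matrixP => i j; rewrite !mxE.
  have [iT|iT] := boolP (i \in T).
    rewrite (bigD1 (enum_rank_in iT i)) //= !mxE enum_rankK_in // eqxx mul1r.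
    rewrite big1 ?addr0; first by rewrite eq_sym; case: eqP.
    move=> l; rewrite !mxE => h; case: eqP => [E|_]; last by rewrite mul0r.
    by case/eqP: h; apply: enum_val_inj; rewrite enum_rankK_in.
  rewrite mul0rn big1 // => l _; rewrite !mxE; case: eqP => [E|_]; last by rewrite mul0r.
  by rewrite E enum_valP in iT.
by apply: leq_trans (mxrankM_maxl _ _) _; apply: rank_leq_col.
Qed.

Lemma coord_projD (R : pzRingType) n (T : {set 'I_n}) :
  @coord_proj R n T + coord_proj (~: T) = 1%:M.
Proof.
apply/matrixP => i j; rewrite !mxE inE.
by case: (i == j) => /=; [case: (i \in T) | ]; rewrite /= ?addr0 ?add0r ?mulr0n.
Qed.

(** The upper bounds for [T] and its complement are both attained, because the two projections sum
    to the identity, of rank [n]. *)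
Lemma coord_proj_rank (F : fieldType) n (T : {set 'I_n}) :
  \rank (@coord_proj F n T) = #|T|.
Proof.
apply/eqP; rewrite eqn_leq coord_proj_rank_le /=.
rewrite -(leq_add2r #|~: T|) cardsC card_ord.
rewrite -{1}(mxrank1 F n) -(coord_projD _ _ T).
apply: leq_trans (mxrank_add _ _) _.
by rewrite leq_add2l coord_proj_rank_le.
Qed.

Lemma reg_proj_rank (F : fieldType) n (T : {set 'I_n}) :
  \rank (@reg_proj F n T) = #|T|.*2.
Proof. by rewrite /reg_proj rank_diag_block_mx !coord_proj_rank addnn. Qed.

Lemma reg_projC (R : pzRingType) n (T : {set 'I_n}) :
  @reg_proj R n (~: T) = 1%:M - reg_proj T.
Proof.
rewrite /reg_proj scalar_mx_block -(coord_projD _ _ T) opp_block_mx add_block_mx.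
by rewrite oppr0 !addr0 addrAC subrr add0r.
Qed.

Lemma tr_reg_proj (R : pzRingType) n (T : {set 'I_n}) :
  (@reg_proj R n T)^T = reg_proj T.
Proof. by rewrite /reg_proj tr_block_mx !tr_diag_mx !trmx0. Qed.

Lemma reg_projI (R : pzRingType) n (T T' : {set 'I_n}) :
  @reg_proj R n T *m reg_proj T' = reg_proj (T :&: T').
Proof.
have E : @coord_proj R n T *m coord_proj T' = coord_proj (T :&: T').
  rewrite /coord_proj mulmx_diag; congr diag_mx; apply/rowP => i.
  by rewrite !mxE inE -mulnb natrM.
by rewrite /reg_proj mulmx_block !mulmx0 !mul0mx !addr0 !add0r E.
Qed.

Lemma reg_proj_symp (R : pzRingType) n (T : {set 'I_n}) :
  reg_proj T *m symp_mx n = symp_mx n *m @reg_proj R n T.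
Proof.
rewrite /reg_proj /symp_mx !mulmx_block !mulmx0 !mul0mx !addr0 !add0r.
by rewrite mulmx1 mul1mx mulmxN mulNmx mulmx1 mul1mx.
Qed.

Lemma map_reg_proj (R S : pzRingType) (f : {rmorphism R -> S}) n (T : {set 'I_n}) :
  map_mx f (reg_proj T) = reg_proj T.
Proof.
rewrite map_block_mx !map_mx0 /reg_proj; congr block_mx;
by apply/matrixP => i j; rewrite !mxE rmorphMn rmorph_nat.
Qed.

Definition psupp {R : nmodType} {n} (a b : 'rV[R]_n) : {set 'I_n} :=
  [set t | (a 0 t != 0) || (b 0 t != 0)].

Lemma mul_reg_projE (R : pzRingType) n (T : {set 'I_n}) (a b : 'rV[R]_n) :
  row_mx a b *m reg_proj T =
  row_mx (\row_t (if t \in T then a 0 t else 0)) (\row_t (if t \in T then b 0 t else 0)).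
Proof.
rewrite /reg_proj mul_row_block !mulmx0 addr0 add0r !mul_mx_diag.
by congr row_mx; apply/rowP => t; rewrite !mxE; case: ifP => _; rewrite ?mulr1 ?mulr0.
Qed.

Lemma reg_proj_supp (R : pzRingType) n (T : {set 'I_n}) (a b : 'rV[R]_n) :
  psupp a b \subset T -> row_mx a b *m reg_proj T = row_mx a b.
Proof.
move=> /subsetP sT; rewrite mul_reg_projE.
by congr row_mx; apply/rowP => t; rewrite !mxE; case: ifP => // tT;
  have := contraNN (sT t) (negbT tT); rewrite inE negb_or !negbK => /andP[/eqP ? /eqP ?].
Qed.

Lemma psupp_reg_proj (R : pzRingType) n (T : {set 'I_n}) (a b : 'rV[R]_n) :
  row_mx a b *m reg_proj T = row_mx a b -> psupp a b \subset T.
Proof.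
rewrite mul_reg_projE => /eq_row_mx [/rowP ha /rowP hb].
apply/subsetP => t; rewrite inE; apply: contraLR => tT.
by rewrite negb_or !negbK -ha -hb !mxE (negPf tT) eqxx.
Qed.

(** * Rank-one updates of a matrix *)

Lemma row_sub_update (F : fieldType) m n (A : 'M[F]_(m, n)) (u : 'cV_m) (v : 'rV_n) :
  (v <= (A + u *m v)%R)%MS -> (A <= (A + u *m v)%R)%MS.
Proof.
move=> h; rewrite -{1}[A](addrK (u *m v)).
by rewrite addmx_sub ?submx_refl // eqmx_opp (submx_trans (submxMl _ _)).
Qed.

(** Some column of the cokernel of [A^T] pairs nontrivially with [u]; dividing by the value of this
    pairing normalises it. *)
Lemma left_annihilator (F : fieldType) m n (A : 'M[F]_(m, n)) (u : 'cV_m) :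
  ~~ (u^T <= A^T)%MS -> exists f : 'rV_m, f *m A = 0 /\ f *m u = 1%:M.
Proof.
rewrite submxE => /rowV0Pn[w /submxP[z ->] w0].
have : (u^T *m cokermx A^T) != 0.
  by apply: contraNneq w0 => ->; rewrite mulmx0.
case/matrix0Pn=> i [j]; rewrite ord1 => nz.
set s := (X in X != 0) in nz.
have E : (col j (cokermx A^T))^T *m u = s%:M.
  rewrite -[LHS]trmxK trmx_mul trmxK colE mulmxA -colE; apply/matrixP => a b.
  by rewrite !ord1 [LHS]mxE [LHS]mxE [RHS]mxE.
exists (s^-1 *: (col j (cokermx A^T))^T); split; rewrite -scalemxAl.
  rewrite -[_ *m A]trmxK trmx_mul trmxK colE mulmxA mulmx_coker mul0mx.
  by rewrite trmx0 scaler0.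
by rewrite E scale_scalar_mx mulVf.
Qed.

(** Multiplying the update by [f], with [f *m A = 0] and [f *m u = 1], yields [v]; the new row space
    thus contains [v] and then all of [A]. *)
Lemma rank_update_gt (F : fieldType) m n (A : 'M[F]_(m, n)) (u : 'cV_m) (v : 'rV_n) :
  ~~ (v <= A)%MS -> ~~ (u^T <= A^T)%MS -> (\rank A < \rank (A + u *m v)%R)%N.
Proof.
move=> vA /left_annihilator[f [fA fu]].
have vB : (v <= (A + u *m v)%R)%MS.
  by apply/submxP; exists f; rewrite mulmxDr fA add0r mulmxA fu mul1mx.
apply: rank_ltmx; apply/andP; split; first exact: row_sub_update.
by apply: contra vA; apply: submx_trans.
Qed.

(* The rank drops only if [1 + c * (y *m u) = 0], where [v = y *m A]: at most
   one value of [c] is bad. *)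
Lemma rank_update_ge_row (F : archiNumFieldType) m n (A : 'M[F]_(m, n))
    (u : 'cV_m) (v : 'rV_n) :
  (v <= A)%MS ->
  exists M, forall c, (M < c)%N -> (\rank A <= \rank (A + (c%:R *: u) *m v)%R)%N.
Proof.
case/submxP => y vE; pose s := (y *m u) 0 0.
have yu : y *m u = s%:M by apply/matrixP => i j; rewrite !ord1 [RHS]mxE.
(* The bad value is [- s^-1]. If [s = 0] there is none, and the convention [0^-1 = 0] still gives a
   valid bound. *)
exists (Num.Def.archi_bound `|s^-1|) => c cM; apply: mxrankS; apply: row_sub_update.
have nz : 1 + c%:R * s != 0.
  rewrite addrC addr_eq0; apply/eqP => E.
  have s0 : s != 0.
    apply/eqP => s0; move: E; rewrite s0 mulr0 => /eqP.
    by rewrite eq_sym oppr_eq0 oner_eq0.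
  have cE : c%:R = - s^-1 by rewrite -[LHS](mulfK s0) E mulN1r.
  have := archi_boundP (normr_ge0 s^-1); rewrite -[ltLHS]normrN -cE normr_nat ltr_nat.
  by rewrite ltnNge (ltnW cM).
have : (((1 + c%:R * s) *: v)%R <= (A + (c%:R *: u) *m v)%R)%MS.
  apply/submxP; exists y; rewrite mulmxDr -vE mulmxA -scalemxAr yu.
  by rewrite scale_scalar_mx mul_scalar_mx scalerDl scale1r.
by rewrite eqmx_scale.
Qed.

(** If [u] lies in the column space or [v] in the row space, the previous lemma applies, after
    transposition in the first case; otherwise every [c > 0] raises the rank. *)
Lemma rank_update_ge (F : archiNumFieldType) m n (A : 'M[F]_(m, n))
    (u : 'cV_m) (v : 'rV_n) :
  exists M, forall c, (M < c)%N -> (\rank A <= \rank (A + (c%:R *: u) *m v)%R)%N.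
Proof.
have [uA|uA] := boolP (u^T <= A^T)%MS.
  have [M hM] := rank_update_ge_row _ _ _ _ v^T _ uA; exists M => c /hM hc.
  have -> : A + (c%:R *: u) *m v = (A^T + (c%:R *: v^T) *m u^T)^T.
    by rewrite linearD /= trmx_mul linearZ /= !trmxK -scalemxAl scalemxAr.
  by rewrite mxrank_tr -(mxrank_tr A).
have [vA|vA] := boolP (v <= A)%MS; first exact: rank_update_ge_row.
exists 0%N => c c0; apply: ltnW; apply: rank_update_gt => //.
by rewrite linearZ /= eqmx_scale // pnatr_eq0 -lt0n.
Qed.

(** * Correctable sets of registers and isotropic families *)

Lemma correctable_rank (F : fieldType) m n (S : 'M[F]_(m, n + n)) (T : {set 'I_n}) :
  (forall x : 'rV_(n + n),
     x *m symp_mx n *m S^T = 0 -> x *m reg_proj T = x -> (x <= S)%MS) ->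
  (#|T|.*2 + \rank (S *m reg_proj (~: T)) <= \rank S + \rank (S *m reg_proj T))%N.
Proof.
move=> hT.
(* Two dimension counts: vectors on [T] orthogonal to [S], and elements of the span of [S] vanishing
   off [T]. The hypothesis embeds the first space into the second. *)
have e1 := mxrank_mul_ker (reg_proj T) (symp_mx n *m S^T).
have e2 := mxrank_mul_ker S (reg_proj (~: T)).
have r1 : \rank (reg_proj T *m (symp_mx n *m S^T)) = \rank (S *m reg_proj T).
  rewrite mulmxA reg_proj_symp -mulmxA -mxrank_tr !trmx_mul trmxK tr_reg_proj.
  by rewrite tr_symp_mx mulmxN mxrank_opp rank_mul_symp.
have le : (reg_proj T :&: kermx (symp_mx n *m S^T) <= S :&: kermx (reg_proj (~: T)))%MS.
  apply/rV_subP => x; rewrite !sub_capmx => /andP[/submxP[y xE]].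
  rewrite sub_kermx mulmxA => /eqP xS.
  have xP : x *m reg_proj T = x by rewrite xE -mulmxA reg_projI setIid.
  by rewrite hT //= sub_kermx reg_projC mulmxBr mulmx1 xP subrr.
by move: (mxrankS le) e1 e2; rewrite r1 reg_proj_rank; lia.
Qed.

(* Adding the inequalities of [correctable_rank] for [T] and [T'], and using that
   restriction to [T] has rank at most that of restriction to [~: T'], cancels
   all the ranks of restrictions. *)
Lemma correctable_disjoint_card (F : fieldType) m n (S : 'M[F]_(m, n + n))
    (T T' : {set 'I_n}) :
  [disjoint T & T'] ->
  (forall x : 'rV_(n + n),
     x *m symp_mx n *m S^T = 0 -> x *m reg_proj T = x -> (x <= S)%MS) ->
  (forall x : 'rV_(n + n),
     x *m symp_mx n *m S^T = 0 -> x *m reg_proj T' = x -> (x <= S)%MS) ->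
  (#|T| + #|T'| <= \rank S)%N.
Proof.
move=> dis /correctable_rank h /correctable_rank h'.
have mono (U V : {set 'I_n}) : U \subset V ->
    (\rank (S *m reg_proj U) <= \rank (S *m reg_proj V))%N.
  move=> /setIidPr <-; rewrite -reg_projI mulmxA; exact: mxrankM_maxl.
have m1 : (\rank (S *m reg_proj T) <= \rank (S *m reg_proj (~: T')))%N.
  by apply: mono; rewrite -disjoints_subset.
have m2 : (\rank (S *m reg_proj T') <= \rank (S *m reg_proj (~: T)))%N.
  by apply: mono; rewrite -disjoints_subset disjoint_sym.
lia.
Qed.

Lemma isotropic_rank (F : fieldType) m n (S : 'M[F]_(m, n + n)) :
  S *m symp_mx n *m S^T = 0 -> (\rank S <= n)%N.
Proof.
move/mulmx0_rank_max; rewrite rank_mul_symp mxrank_tr.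
lia.
Qed.

(** * Passing between the field with [q] elements, the integers and characteristic 0 *)

Definition int_mx {R : pzRingType} {m n} (A : 'M[int]_(m, n)) : 'M[R]_(m, n) :=
  map_mx intr A.

Definition lift_mx {q m n} (A : 'M['F_q]_(m, n)) : 'M[int]_(m, n) :=
  map_mx (@liftq q) A.

Lemma lift_mxK q m n (A : 'M['F_q]_(m, n)) : int_mx (lift_mx A) = A.
Proof.
apply/matrixP => i j; rewrite !mxE /liftq -[LHS]/((A i j : nat)%:R).
exact: natr_Zp.
Qed.

(* The determinant of [H] times a lifted right inverse is 1 mod [q], and its
   adjugate clears the denominators. *)
Lemma int_row_free_inv q m n (H : 'M[int]_(m, n)) :
  row_free (int_mx H : 'M['F_q]_(m, n)) ->
  exists (W : 'M[int]_(n, m)) (D : int), H *m W = D%:M /\ D%:~R != 0 :> 'F_q.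
Proof.
case/row_freeP => V HV; set B := H *m lift_mx V.
exists (lift_mx V *m \adj B), (\det B); rewrite mulmxA mul_mx_adj; split=> //.
by rewrite -det_map_mx map_mxM -!/(int_mx _) lift_mxK HV det1 oner_neq0.
Qed.

(** The integer [D] is nonzero mod [q], hence nonzero, hence invertible in [K]. *)
Lemma int_row_free_num q (K : numFieldType) m n (H : 'M[int]_(m, n)) :
  row_free (int_mx H : 'M['F_q]_(m, n)) -> row_free (int_mx H : 'M[K]_(m, n)).
Proof.
case/int_row_free_inv => W [D [HW D0]].
have DK : D%:~R != 0 :> K.
  by rewrite intr_eq0; apply: contraNneq D0 => ->.
apply/row_freeP; exists (D%:~R^-1 *: int_mx W).
rewrite -scalemxAr -map_mxM HW map_scalar_mx scale_scalar_mx.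
by rewrite mulVf.
Qed.

(** Induction on the generators: each new lift is corrected to be exactly orthogonal to [l] and to
    the generators already lifted. Rescaling by the unit [D] keeps the correction integral. *)
Lemma isotropic_lift q n m (l : 'rV[int]_(n + n)) (S : 'M['F_q]_(m, n + n)) :
  row_free (col_mx (int_mx l) S) ->
  int_mx l *m symp_mx n *m S^T = 0 -> S *m symp_mx n *m S^T = 0 ->
  exists G : 'M[int]_(m, n + n),
    [/\ (int_mx G == S)%MS, l *m symp_mx n *m G^T = 0 & G *m symp_mx n *m G^T = 0].
Proof.
elim: m S => [|m IH] S.
  by exists 0; rewrite trmx0 !mulmx0 (flatmx0 S) (flatmx0 (int_mx 0)) submx_refl.
rewrite -[m.+1]/(1 + m)%N in S *.
have [s [S' ->]] : exists s S', S = col_mx s S'.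
  by exists (usubmx S), (dsubmx S); rewrite vsubmxK.
move=> {S} free; rewrite tr_col_mx !mul_mx_row !mul_col_mx.
move=> /eqP; rewrite row_mx_eq0 => /andP[/eqP lJs /eqP lJS].
move=> /eqP; rewrite row_mx_eq0 !col_mx_eq0.
case/andP => _ /andP[/eqP sJS /eqP SJS].
have rk : \rank (int_mx l + (s + S'))%MS = m.+2.
  rewrite -(eqP free : _ = m.+2) -addsmxE.
  by rewrite (adds_eqmx (eqmx_refl _) (addsmxE s S')).
have freeS : row_free (col_mx (int_mx l) S').
  rewrite /row_free eqn_leq rank_leq_row -addsmxE.
  have := (mxrank_adds_leqif (int_mx l + S')%MS s).1.
  rewrite -addsmxA (addsmxC S') rk => /leq_trans/(_ (leq_add (leqnn _) (rank_leq_row s))).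
  by rewrite addn1.
have [G [/eqmxP GS lG GG]] := IH S' freeS lJS SJS.
have freeH : row_free (int_mx (col_mx l G) : 'M['F_q]_(1 + m, n + n)).
  by rewrite /int_mx map_col_mx /row_free -addsmxE (adds_eqmx (eqmx_refl _) GS) addsmxE.
have [W [D [HW D0]]] := int_row_free_inv _ _ _ _ freeH.
set H := col_mx l G in HW freeH.
(* The error to correct: the integer products of the naive lift of [s] with [l] and [G], all
   divisible by [q]. *)
pose c := lift_mx s *m symp_mx n *m H^T.
have c0 : int_mx c = 0 :> 'M['F_q]_(_, _).
  rewrite /c /int_mx !map_mxM -map_trmx map_symp_mx -!/(int_mx _) lift_mxK.
  rewrite /int_mx map_col_mx tr_col_mx mul_mx_row -!/(int_mx _).
  rewrite (symp_mx_orthC _ _ _ _ _ _ lJs).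
  have /submxP[Y ->] : (int_mx G <= S')%MS by rewrite GS.
  by rewrite trmx_mul mulmxA sJS mul0mx row_mx0.
(* [int_mx c = 0], so [s'] still reduces to a unit multiple of [s]. *)
pose s' := D *: lift_mx s + c *m W^T *m symp_mx n.
have s'H : s' *m symp_mx n *m H^T = 0.
  rewrite /s' !mulmxDl -!scalemxAl -/c -[_ *m symp_mx n *m symp_mx n]mulmxA.
  rewrite symp_mx_sqr mulmxN mulmx1 mulNmx -mulmxA -trmx_mul HW tr_scalar_mx.
  by rewrite mul_mx_scalar subrr.
have s'E : int_mx s' = D%:~R *: s.
  rewrite /s' /int_mx map_mxD map_mxZ 2!map_mxM -!/(int_mx _) c0 !mul0mx addr0.
  by rewrite lift_mxK.
move: s'H; rewrite tr_col_mx mul_mx_row => /eqP; rewrite row_mx_eq0.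
case/andP => /eqP s'l /eqP s'G.
exists (col_mx s' G); split.
- rewrite /int_mx map_col_mx -!/(int_mx _) s'E; apply/eqmxP.
  apply: eqmx_trans (eqmx_sym (addsmxE _ _)) _; apply: eqmx_trans (addsmxE _ _).
  by apply: adds_eqmx GS; apply: eqmx_scale.
- by rewrite tr_col_mx mul_mx_row lG (symp_mx_orthC _ _ _ _ _ _ s'l) row_mx0.
rewrite tr_col_mx mul_mx_row !mul_col_mx symp_mx_self s'G GG.
by rewrite (symp_mx_orthC _ _ _ _ _ _ s'G) !col_mx0 row_mx0.
Qed.

(** * Transvections that raise the ranks of restrictions *)

Lemma submx_addl (F : fieldType) m1 m2 n (x y : 'M[F]_(m1, n)) (A : 'M_(m2, n)) :
  (y <= A)%MS -> ((x + y)%R <= A)%MS = (x <= A)%MS.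
Proof.
move=> yA; apply/idP/idP => [xyA|xA]; last exact: addmx_sub.
by rewrite -[x](addrK y) addmx_sub // eqmx_opp.
Qed.

Lemma int_mxM (R : pzRingType) m n p (A : 'M[int]_(m, n)) (B : 'M_(n, p)) :
  int_mx (A *m B) = int_mx A *m int_mx B :> 'M[R]_(m, p).
Proof. exact: map_mxM. Qed.

Lemma int_mx_reg_proj (R : pzRingType) n (T : {set 'I_n}) :
  int_mx (reg_proj T) = reg_proj T :> 'M[R]_(n + n).
Proof. exact: map_reg_proj. Qed.

(* By [rank_update_gt], the transvection along such a [w] increases the rank of
   the restriction of [G] to [T]. *)
Lemma orth_direction q (K : numFieldType) m n (l : 'rV[int]_(n + n))
    (G : 'M[int]_(m, n + n)) (T : {set 'I_n}) :
  row_free (int_mx (col_mx l G) : 'M['F_q]_(1 + m, n + n)) ->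
  l *m reg_proj T != l ->
  (\rank (int_mx (G *m reg_proj T) : 'M[K]_(m, n + n)) < #|T|.*2)%N ->
  (\rank (int_mx (G *m reg_proj T) : 'M[K]_(m, n + n)) < m)%N ->
  exists w : 'rV[int]_(n + n),
    [/\ l *m symp_mx n *m w^T = 0,
        ~~ (int_mx (w *m reg_proj T) <= (int_mx (G *m reg_proj T) : 'M[K]_(m, n + n)))%MS &
        ~~ ((int_mx (G *m symp_mx n *m w^T))^T <=
            (int_mx (G *m reg_proj T) : 'M[K]_(m, n + n))^T)%MS].
Proof.
move=> free lT rkT rkm; set A := int_mx (G *m reg_proj T) in rkT rkm *.
have [x [lx xA]] : exists x : 'rV[int]_(n + n), l *m symp_mx n *m x^T = 0 /\
    ~~ (int_mx (x *m reg_proj T) <= A)%MS.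
  have /row_subPn[i iA] : ~~ (@reg_proj K n T <= A)%MS.
    apply: contraL rkT => /mxrankS; rewrite reg_proj_rank -leqNgt; exact.
  (* Since [l] is not supported on [T], it pairs nontrivially with a row of the projection off [T].
     A multiple of that row restores orthogonality to [l] without affecting the restriction to
     [T]. *)
  have : l *m reg_proj (~: T) *m symp_mx n != 0.
    apply: contraNneq lT => /(congr1 (mulmx^~ (symp_mx n))).
    rewrite /= -[LHS]mulmxA symp_mx_sqr mulmxN mulmx1 mul0mx reg_projC mulmxBr mulmx1.
    by rewrite opprB => /eqP; rewrite subr_eq0.
  case/matrix0Pn=> i0 [j]; rewrite {i0}ord1; set lam := (X in X != 0) => lam0.
  pose mu := (l *m symp_mx n *m (row i (reg_proj T))^T) 0 0.
  exists (lam *: row i (reg_proj T) - mu *: row j (reg_proj (~: T))); split.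
    apply/matrixP => a b; rewrite !ord1 [RHS]mxE.
    rewrite [(_ - _)^T]linearB /= ![(_ *: _)^T]linearZ /= mulmxBr -!scalemxAr.
    rewrite [LHS]mxE [X in X + _]mxE [X in _ + X]mxE [X in _ - X]mxE -/mu.
    have -> : (l *m symp_mx n *m (row j (reg_proj (~: T)))^T) 0 0 = lam.
      rewrite tr_row tr_reg_proj colE mulmxA -[l *m _ *m _]mulmxA -reg_proj_symp mulmxA.
      by rewrite -colE [LHS]mxE.
    by rewrite mulrC subrr.
  have -> : int_mx ((lam *: row i (reg_proj T) - mu *: row j (reg_proj (~: T))) *m
      reg_proj T) = lam%:~R *: row i (reg_proj T) :> 'M[K]_(1, n + n).
    rewrite mulmxBl -!scalemxAl -!row_mul !reg_projI [~: T :&: T]setIC setICr.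
    have -> : reg_proj set0 = 0 :> 'M[int]_(n + n).
      by rewrite -(setICr T) -reg_projI reg_projC mulmxBr mulmx1 reg_projI setIid subrr.
    by rewrite row0 scaler0 subr0 setIid /int_mx map_mxZ map_row map_reg_proj.
  by rewrite eqmx_scale // intr_eq0.
have [y [ly yA]] : exists y : 'rV[int]_(n + n), l *m symp_mx n *m y^T = 0 /\
    ~~ ((int_mx (G *m symp_mx n *m y^T))^T <= A^T)%MS.
  have /row_subPn[j jA] : ~~ (1%:M <= A^T)%MS.
    apply: contraL rkm => /mxrankS; rewrite mxrank1 mxrank_tr -leqNgt; exact.
  have [W [D [HW D0]]] := int_row_free_inv _ _ _ _ free.
  pose z : 'cV[int]_(1 + m) := col_mx 0 (delta_mx j 0).
  (* As [W] is a right inverse up to [D], this vector has product 0 with [l] and products [D] times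
     a chosen unit vector with [G]. *)
  exists ((W *m z)^T *m symp_mx n).
  have : col_mx l G *m symp_mx n *m ((W *m z)^T *m symp_mx n)^T = D *: z.
    rewrite trmx_mul trmxK tr_symp_mx mulNmx mulmxN -mulmxA [symp_mx n *m _]mulmxA.
    by rewrite symp_mx_sqr mulNmx mul1mx mulmxN opprK mulmxA HW mul_scalar_mx.
  rewrite !mul_col_mx scale_col_mx scaler0 => /eq_col_mx[-> ->]; split=> //.
  rewrite /int_mx map_mxZ map_delta_mx linearZ /= trmx_delta.
  rewrite eqmx_scale; first by rewrite -row1.
  by rewrite intr_eq0; apply: contraNneq D0 => ->.
(* Each of [x] and [y] meets one requirement; if neither meets both, their sum does. *)
have [xB|xB] := boolP ((int_mx (G *m symp_mx n *m x^T))^T <= A^T)%MS; last by exists x.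
have [yB|yB] := boolP (int_mx (y *m reg_proj T) <= A)%MS; last by exists y.
exists (x + y); rewrite linearD /= mulmxDr lx ly addr0 mulmxDl mulmxDr; split=> //.
  by rewrite [int_mx (_ + _)]map_mxD -!/(int_mx _) submx_addl.
by rewrite [int_mx (_ + _)]map_mxD linearD /= -!/(int_mx _) addrC submx_addl.
Qed.

Lemma mod_q_transvection q n m (B : 'M[int]_(m, n)) c :
  prime q -> int_mx ((c * q)%:R *: B) = 0 :> 'M['F_q]_(m, n).
Proof.
move=> q_pr; rewrite /int_mx map_mxZ /= rmorph_nat natrM.
by rewrite pchar_Fp_0 // mulr0 scale0r.
Qed.

(** Transvections are symplectic: the two terms linear in [c] cancel by skew-symmetry, and the
    quadratic one contains the product of [w] with itself. *)
Lemma transvection_isotropic m n (G : 'M[int]_(m, n + n)) (w : 'rV_(n + n)) c :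
  G *m symp_mx n *m G^T = 0 ->
  let G' := G + c *: (G *m symp_mx n *m w^T *m w) in
  G' *m symp_mx n *m G'^T = 0.
Proof.
move=> GG /=.
have [U UE wG] : exists2 U, G *m symp_mx n *m w^T = U & w *m symp_mx n *m G^T = - U^T.
  exists (G *m symp_mx n *m w^T) => //.
  by rewrite !trmx_mul trmxK tr_symp_mx mulNmx mulmxN opprK mulmxA.
rewrite UE linearD linearZ /= trmx_mul.
rewrite !mulmxDl !mulmxDr GG add0r -!scalemxAl -!scalemxAr !mulmxA UE.
rewrite -(mulmxA U w) -(mulmxA U (w *m _)) wG.
rewrite -(mulmxA U (w *m symp_mx n)) symp_mx_self mulmx0 mul0mx !scaler0 addr0.
by rewrite mulmxN scalerN subrr.
Qed.

Lemma generic_transvection (q n m d : nat) (l : 'rV[int]_(n + n))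
    (G : 'M[int]_(m, n + n)) :
  prime q ->
  row_free (int_mx (col_mx l G) : 'M['F_q]_(1 + m, n + n)) ->
  (forall T : {set 'I_n}, (#|T| < d)%N -> l *m reg_proj T != l) ->
  (forall T : {set 'I_n}, (#|T| < d)%N -> (#|T|.*2 <= m)%N) ->
  l *m symp_mx n *m G^T = 0 -> G *m symp_mx n *m G^T = 0 ->
  exists G' : 'M[int]_(m, n + n),
    [/\ int_mx G' = int_mx G :> 'M['F_q]_(m, n + n),
        l *m symp_mx n *m G'^T = 0, G' *m symp_mx n *m G'^T = 0 &
        forall T : {set 'I_n}, (#|T| < d)%N ->
          \rank (int_mx (G' *m reg_proj T) : 'M[rat]_(m, n + n)) = #|T|.*2].
Proof.
move=> q_pr free lT dT lG GG.
pose rk (H : 'M[int]_(m, n + n)) (T : {set 'I_n}) :=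
  \rank (int_mx (H *m reg_proj T) : 'M[rat]_(m, n + n)).
have rk_le H T : (rk H T <= #|T|.*2)%N.
  rewrite /rk int_mxM int_mx_reg_proj -(reg_proj_rank rat); exact: mxrankM_maxr.
(* The sum ranges over all [T], also those with at least [d] elements; since no rank ever drops, one
   increase lowers it. *)
pose defect H := (\sum_(T : {set 'I_n}) (#|T|.*2 - rk H T))%N.
have [N] := ubnP (defect G); elim: N => // N IH in G free lG GG *.
move=> GN.
have [full|] := boolP [forall T : {set 'I_n}, (#|T| < d)%N ==> (rk G T == #|T|.*2)].
  by exists G; split=> // T Td; apply/eqP; apply: (implyP (forallP full T)).
rewrite negb_forall => /existsP[T0]; rewrite negb_imply => /andP[T0d rk0].
have {}rk0 : (rk G T0 < #|T0|.*2)%N by rewrite ltn_neqAle rk0 rk_le.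
have [w [lw wG Gw]] := orth_direction q rat _ _ _ _ _ free (lT _ T0d) rk0
  (leq_trans rk0 (dT _ T0d)).
(* The factor [q], which keeps the generators fixed mod [q], is absorbed in [u], leaving [c] free to
   avoid the bad values of all [T] at once. *)
pose u : 'cV[rat]_m := q%:R *: int_mx (G *m symp_mx n *m w^T).
pose v (T : {set 'I_n}) : 'rV[rat]_(n + n) := int_mx (w *m reg_proj T).
have /fin_all_exists[M hM] := fun T : {set 'I_n} =>
  rank_update_ge _ _ _ (int_mx (G *m reg_proj T)) u (v T).
pose c := (\max_T M T).+1.
pose G' := G + (c * q)%:R *: (G *m symp_mx n *m w^T *m w).
have G'E T : int_mx (G' *m reg_proj T) =
    int_mx (G *m reg_proj T) + (c%:R *: u) *m v T.
  rewrite /G' mulmxDl -scalemxAl -[_ *m w *m _]mulmxA /int_mx map_mxD map_mxZ map_mxM.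
  by rewrite /= rmorph_nat natrM scalerA -scalemxAl.
have rk_ge T : (rk G T <= rk G' T)%N.
  by rewrite /rk G'E hM // ltnS leq_bigmax.
have rk_gt : (rk G T0 < rk G' T0)%N.
  rewrite /rk G'E rank_update_gt // linearZ /= linearZ /= scalerA eqmx_scale //.
  by rewrite -natrM pnatr_eq0 muln_eq0 negb_or -!lt0n (prime_gt0 q_pr).
have eG : int_mx G' = int_mx G :> 'M['F_q]_(m, n + n).
  by rewrite /G' [LHS]map_mxD -!/(int_mx _) mod_q_transvection ?addr0.
have [] := IH G'.
- by rewrite /int_mx map_col_mx -!/(int_mx _) eG -map_col_mx.
- rewrite /G' linearD linearZ /= mulmxDr lG add0r -scalemxAr.
  by rewrite trmx_mul mulmxA lw mul0mx scaler0.
- exact: transvection_isotropic.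
- rewrite -ltnS; apply: leq_trans GN; rewrite ltnS.
  rewrite /defect (bigD1 T0) //= [X in (_ < X)%N](bigD1 T0) //= -addSn leq_add //.
    exact: ltn_sub2l rk0 rk_gt.
  by apply: leq_sum => T _; apply: leq_sub2l.
by move=> H [eH lH HH fH]; exists H; split; rewrite ?eH.
Qed.

(** * From ranks to distances *)

Lemma logical_supp_card (K : fieldType) m n (G : 'M[K]_(m, n + n)) (T : {set 'I_n})
    (x : 'rV[K]_(n + n)) :
  \rank (G *m reg_proj T) = #|T|.*2 ->
  x *m symp_mx n *m G^T = 0 -> x *m reg_proj T = x -> x = 0.
Proof.
move=> rkT xG xT.
(* Full rank makes the restricted generators span every vector on [T], so [x] is orthogonal to all
   of these; nondegeneracy of the form on [T] then forces [x = 0]. *)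
have /submxP[Y YE] : (reg_proj T <= G *m reg_proj T)%MS.
  by rewrite -(mxrank_leqif_sup (submxMl G _)).2 rkT reg_proj_rank.
apply/eqP; rewrite -mxrank_eq0 -rank_mul_symp mxrank_eq0 -xT -mulmxA reg_proj_symp.
rewrite -(tr_reg_proj _ _ T) YE !trmx_mul tr_reg_proj !mulmxA.
by rewrite -[x *m _ *m reg_proj T]mulmxA -reg_proj_symp mulmxA xT xG mul0mx.
Qed.

Lemma ex_subset_card {T : finType} {B : {set T}} {k} :
  (k <= #|B|)%N -> exists2 A : {set T}, A \subset B & #|A| = k.
Proof.
rewrite -bin_gt0 -cards_draws card_gt0 => /set0Pn[A].
by rewrite inE => /andP[AB /eqP Ak]; exists A.
Qed.

(** Ranks fixed over the rationals transfer to every real field, so a single integer family serves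
    all of them. *)
Lemma rank_int_mx_rat (K : numFieldType) m n (A : 'M[int]_(m, n)) :
  \rank (int_mx A : 'M[K]_(m, n)) = \rank (int_mx A : 'M[rat]_(m, n)).
Proof.
rewrite -(mxrank_map (ratr : rat -> K)); congr (\rank _).
by apply/matrixP => i j; rewrite !mxE /= ratr_int.
Qed.

Lemma psupp_lift (K : numDomainType) q n (a b : 'rV['F_q]_n) :
  psupp (int_mx (lift_mx a) : 'rV[K]_n) (int_mx (lift_mx b)) = psupp a b.
Proof.
have E (x : 'F_q) : ((liftq x)%:~R == 0 :> K) = (x == 0).
  rewrite intr_eq0 /liftq -[RHS](inj_eq val_inj) /=; exact: eqz_nat.
by apply/setP => t; rewrite !inE !mxE !E.
Qed.

Lemma q_logicalP q n m (SX SZ : 'M['F_q]_(m, n)) (a b : 'rV['F_q]_n) :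
  q_logical SX SZ a b <->
  row_mx a b *m symp_mx n *m (row_mx SX SZ)^T = 0 /\
  ~~ (row_mx a b <= row_mx SX SZ)%MS.
Proof. by rewrite /q_logical sympl_vecP. Qed.

Lemma unavoidableP q n m (SX SZ : 'M['F_q]_(m, n)) (G : 'M[int]_(m, n + n))
    (a b : 'rV['F_q]_n) :
  unavoidable SX SZ (lsubmx G) (rsubmx G) a b <->
  lift_mx (row_mx a b) *m symp_mx n *m G^T = 0 /\
  ~~ (row_mx a b <= row_mx SX SZ)%MS.
Proof. by rewrite /unavoidable sympl_vecP hsubmxK -map_row_mx. Qed.

Lemma cv_logicalP (R : realType) n m (G : 'M[int]_(m, n + n)) (u v : 'rV[R]_n) :
  cv_logical (lsubmx G) (rsubmx G) u v <->
  row_mx u v *m symp_mx n *m (int_mx G)^T = 0 /\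
  ~~ (row_mx u v <= (int_mx G : 'M[R]_(m, n + n)))%MS.
Proof. by rewrite /cv_logical sympl_vecP -map_row_mx hsubmxK. Qed.

Lemma correctable_of_distance {q n m d} {SX SZ : 'M['F_q]_(m, n)} :
  (forall a b, q_logical SX SZ a b -> (d <= pweight a b)%N) ->
  forall T : {set 'I_n}, (#|T| < d)%N -> forall x : 'rV_(n + n),
  x *m symp_mx n *m (row_mx SX SZ)^T = 0 -> x *m reg_proj T = x ->
  (x <= row_mx SX SZ)%MS.
Proof.
move=> min_d T Td x; rewrite -[x]hsubmxK; move: (lsubmx x) (rsubmx x) => a b xS xT.
apply/idPn => xNS; have /min_d : q_logical SX SZ a b by apply/q_logicalP.
rewrite leqNgt => /negP; apply.
exact: leq_ltn_trans (subset_leq_card (psupp_reg_proj _ _ _ _ _ xT)) Td.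
Qed.

Lemma quantum_singleton {q n k d} {SX SZ : 'M['F_q]_(n - k, n)} :
  stab_code SX SZ -> (0 < k)%N ->
  (forall a b, q_logical SX SZ a b -> (d <= pweight a b)%N) ->
  forall T : {set 'I_n}, (#|T| < d)%N -> (#|T|.*2 <= n - k)%N.
Proof.
move=> [kn rkS _] k0 /correctable_of_distance corr T Td.
have Tn : (#|T| <= n)%N by rewrite -[n in (_ <= n)%N]card_ord max_card.
(* If [T] has at most half of the registers, [T'] has the same size and the bound follows; otherwise
   [T'] is the complement, giving [n <= n - k], impossible as [0 < k]. *)
have [|T' sT' cT'] := @ex_subset_card _ (~: T) (minn #|T| (n - #|T|)).
  by rewrite -[n in (n - _)%N]card_ord -(cardsC T) addKn geq_minr.
have T'd : (#|T'| < d)%N by rewrite cT' (leq_ltn_trans (geq_minl _ _)).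
have := correctable_disjoint_card _ _ _ _ _ _ _ (corr T Td) (corr T' T'd).
rewrite rkS cT' disjoint_sym disjoints_subset => /(_ sT').
lia.
Qed.

(** * Assembling the continuous code *)

Theorem mainTheorem2 (q n k d : nat) (SX SZ : 'M['F_q]_(n - k, n)) :
  prime q ->
  stab_code SX SZ ->
  q_distance SX SZ d ->
  exists (GX GZ : 'M[int]_(n - k, n)),
    LDI_form SX SZ GX GZ /\
    exists d' : nat,
      dstar SX SZ GX GZ d' /\ (d <= d')%N /\
      forall R : realType,
        @cv_logical_modes R n (n - k) GX GZ k /\ @cv_distance R n (n - k) GX GZ d'.
Proof.
move=> q_pr codeS [[a [b [/q_logicalP[LS LNS] wt_ab]]] min_d].
have [kn rkS /sympl_rowP SS] := codeS.
pose S := row_mx SX SZ; pose L := row_mx a b; pose l := lift_mx L.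
have lE : int_mx l = L by apply: lift_mxK.
have freeLS : row_free (col_mx L S).
  rewrite /row_free eqn_leq rank_leq_row -addsmxE add1n -{1}rkS; apply: rank_ltmx.
  by rewrite /ltmx addsmxSr addsmx_sub negb_and LNS.
(* [L] and [S] together are isotropic of rank [n - k + 1], which is at most [n]. *)
have k_gt0 : (0 < k)%N.
  have : (\rank (col_mx L S) <= n)%N.
    apply: isotropic_rank; rewrite tr_col_mx mul_mx_row !mul_col_mx symp_mx_self.
    by rewrite LS SS (symp_mx_orthC _ _ _ _ _ _ LS) !col_mx0 row_mx0.
  by rewrite (eqP freeLS); lia.
have singleton := quantum_singleton codeS k_gt0 min_d.
have lT (T : {set 'I_n}) : (#|T| < d)%N -> l *m reg_proj T != l.
  apply: contraTneq => /(congr1 (@int_mx 'F_q _ _)).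
  rewrite int_mxM int_mx_reg_proj lE => /psupp_reg_proj/subset_leq_card.
  by rewrite -leqNgt; apply: leq_trans; rewrite -wt_ab.
have [G0 [/eqmxP G0S lG0 GG0]] :
    exists G : 'M[int]_(n - k, n + n),
      [/\ (int_mx G == S)%MS, l *m symp_mx n *m G^T = 0 & G *m symp_mx n *m G^T = 0].
  by apply: isotropic_lift; rewrite ?lE.
have freeG0 : row_free (int_mx (col_mx l G0) : 'M['F_q]_(1 + (n - k), n + n)).
  rewrite /int_mx map_col_mx -!/(int_mx _) lE /row_free -addsmxE.
  by rewrite (adds_eqmx (eqmx_refl _) G0S) addsmxE.
have [G [eG lG GG fullG]] :=
  generic_transvection _ _ _ _ _ _ q_pr freeG0 lT singleton lG0 GG0.
have GS : (int_mx G :=: S)%MS by rewrite eG.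
have freeG : row_free (int_mx (col_mx l G) : 'M['F_q]_(1 + (n - k), n + n)).
  by move: freeG0; rewrite /int_mx !map_col_mx -!/(int_mx _) eG.
have rkG (R : realType) : \rank (int_mx G : 'M[R]_(n - k, n + n)) = (n - k)%N.
  apply/eqP; apply: (int_row_free_num q).
  by rewrite /row_free GS rkS.
exists (lsubmx G), (rsubmx G); split.
  split; last by apply/sympl_rowP; rewrite hsubmxK.
  by rewrite -map_row_mx hsubmxK; apply/eqmxP.
exists d; split; last (split=> // R).
  split.
    by exists a, b; split=> //; apply/unavoidableP.
  (* Reducing mod [q] turns an unavoidable error into a logical Pauli, of weight at least [d]. *)
  move=> a' b' /unavoidableP[ab'G ab'NS]; apply: min_d; apply/q_logicalP; split=> //.
  have /submxP[Y ->] : (row_mx SX SZ <= int_mx G)%MS by rewrite GS.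
  rewrite trmx_mul mulmxA.
  have /(congr1 (@int_mx 'F_q _ _)) := ab'G.
  rewrite !int_mxM lift_mxK /int_mx -map_trmx map_symp_mx map_mx0 => ->.
  by rewrite mul0mx.
split.
  by rewrite /cv_logical_modes -map_row_mx hsubmxK; split=> //; apply: rkG.
split.
  exists (int_mx (lift_mx a)), (int_mx (lift_mx b)); split; last first.
    by rewrite -wt_ab; apply: (congr1 (fun A : {set 'I_n} => #|A|)); apply: psupp_lift.
  have lR : row_mx (int_mx (lift_mx a)) (int_mx (lift_mx b)) = int_mx l :> 'rV[R]_(n + n).
    by rewrite /l /int_mx /lift_mx !map_row_mx.
  apply/cv_logicalP; rewrite lR; split.
    have /(congr1 (@int_mx R _ _)) := lG.
    by rewrite !int_mxM /int_mx -map_trmx map_symp_mx map_mx0.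
  (* Independence of [l] and [G] mod [q] persists over the reals, so the lifted [L] acts
     nontrivially on the continuous code. *)
  apply: contraTN (int_row_free_num q R _ _ _ freeG) => lGR.
  rewrite /row_free /int_mx map_col_mx -!/(int_mx _) -addsmxE (addsmx_idPr lGR).
  by rewrite rkG; lia.
(* An undetectable displacement on fewer than [d] modes is zero, hence in the span of the
   nullifiers. *)
move=> u v /cv_logicalP[uvG uvNG]; rewrite leqNgt; apply/negP => wt_uv.
move/negP: uvNG; apply.
have rkT := fullG (psupp u v) wt_uv.
rewrite -(rank_int_mx_rat R) int_mxM int_mx_reg_proj in rkT.
by rewrite (logical_supp_card _ _ _ _ _ _ rkT uvG (reg_proj_supp _ _ _ _ _ _)) ?sub0mx.
Qed.
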